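(* Let $M$ be a Riesz monoid and let $e\in M$. If $e$ has finite stable rank in $M$, then the maximal semilattice quotient $\nabla(M)$ satisfies $\mathrm{URP_{sr}}([e])$.
   Context: All monoids are commutative and written additively. A commutative monoid $M$ is endowed with its algebraic quasi-ordering: $x\leq y$ iff there is $z\in M$ with $x+z=y$. $\mathbb{N}$ denotes the set of positive integers. $M$ is a Riesz monoid if whenever $c\leq a+b$ in $M$ there are $a'\leq a$ and $b'\leq b$ in $M$ with $c=a'+b'$. Stable rank: for $k\in\mathbb{N}$, an element $e\in M$ has stable rank at most $k$ if $ke+a=e+b$ implies $a\leq b$, for all $a,b\in M$. It has finite stable rank if it has stable rank at most $k$ for some $k\in\mathbb{N}$. Maximal semilattice quotient: put $a\propto b$ iff $a\leq nb$ for some $n\in\mathbb{N}$, and $a\asymp b$ iff $a\propto b$ and $b\propto a$. Then $\asymp$ is a monoid congruence, $\nabla(M)=M/{\asymp}$ is a join-semilattice with zero (join induced by $+$), and $[a]$ denotes the $\asymp$-class of $a$. For a join-semilattice $S$ and $A\subseteq S$, $A^{[\wedge 2]}$ is the set of all elements of the form $\bigvee(x_p\mid p\subseteq A',\ |p|=2)$, where $A'$ is a finite subset of $A$ and $x_{\{a,a'\}}\in S$ satisfies $x_{\{a,a'\}}\leq a$ and $x_{\{a,a'\}}\leq a'$ for all distinct $a,a'\in A'$ (the empty join is $0$). A partially ordered set $P$ is $\aleph_0$-downward directed if for every at most countable subset $X$ of $P$ there is an element of $P$ that is $\leq x$ for all $x\in X$. For a join-semilattice $S$ and $e\in S$, $\mathrm{URP_{sr}}(e)$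 is the statement: for all subsets $A,B$ of $S$ such that $A$ is uncountable, $B$ is $\aleph_0$-downward directed, and $a\leq e\leq a\vee b$ for all $(a,b)\in A\times B$, there exists $a\in A^{[\wedge 2]}$ such that $e\leq a\vee b$ for all $b\in B$. *)

(* Defs.v *)
From HB Require Import structures.
From mathcomp Require Import all_boot all_order all_algebra.
From mathcomp Require Import generic_quotient finmap.
From mathcomp Require Import boolp classical_sets cardinality.

Set Implicit Arguments.
Unset Strict Implicit.
Unset Printing Implicit Defensive.

Import Order.TTheory GRing.Theory.

Local Open Scope classical_set_scope.
Local Open Scope quotient_scope.
Local Open Scope ring_scope.

(* Commutative monoids, written additively, are rendered as [nmodType]. *)
Section Monoids.
Variable M : nmodType.
Implicit Types (a b c e : M).

(* Algebraic quasi-ordering: a reflexive and transitive relation, in general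
   not antisymmetric, hence not an instance of the library's orders. *)
Definition alg_le a b : Prop := exists z, a + z = b.

Definition Riesz_monoid : Prop :=
  forall a b c, alg_le c (a + b) ->
    exists a' b', [/\ alg_le a' a, alg_le b' b & c = a' + b'].

Definition stable_rank_le (k : nat) e : Prop :=
  forall a b, e *+ k + a = e + b -> alg_le a b.

Definition finite_stable_rank e : Prop :=
  exists k : nat, (0 < k)%N /\ stable_rank_le k e.

Definition propto a b : Prop := exists n : nat, (0 < n)%N /\ alg_le a (b *+ n).

Definition asymp a b : Prop := propto a b /\ propto b a.

Lemma alg_le_refl a : alg_le a a.
Proof. by exists 0; rewrite addr0. Qed.

Lemma alg_le_trans b a c : alg_le a b -> alg_le b c -> alg_le a c.
Proof. by move=> [x <-] [y <-]; exists (x + y); rewrite addrA. Qed.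

Lemma alg_leD a b c d : alg_le a b -> alg_le c d -> alg_le (a + c) (b + d).
Proof. by move=> [x <-] [y <-]; exists (x + y); rewrite addrACA. Qed.

Lemma alg_leMn n a b : alg_le a b -> alg_le (a *+ n) (b *+ n).
Proof. by move=> [x <-]; exists (x *+ n); rewrite mulrnDl. Qed.

Lemma propto_refl a : propto a a.
Proof. by exists 1%N; split => //; exact: alg_le_refl. Qed.

Lemma propto_trans b a c : propto a b -> propto b c -> propto a c.
Proof.
move=> [m [m0 ab]] [n [n0 bc]]; exists (n * m)%N.
split; first by rewrite muln_gt0 n0.
by apply: alg_le_trans ab _; rewrite mulrnA; exact: alg_leMn.
Qed.

Lemma proptoDl a b : propto a (a + b).
Proof. by exists 1%N; split => //; exists b. Qed.

Lemma proptoDr a b : propto b (a + b).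
Proof. by rewrite addrC; exact: proptoDl. Qed.

Lemma proptoD a b c : propto a c -> propto b c -> propto (a + b) c.
Proof.
move=> [m [m0 ac]] [n [n0 bc]]; exists (m + n)%N.
by rewrite addn_gt0 m0; split => //; rewrite mulrnDr; exact: alg_leD.
Qed.

Lemma propto0 a : propto 0 a.
Proof. by exists 1%N; split => //; exists a; rewrite add0r. Qed.

Lemma asympD a a' b b' : asymp a a' -> asymp b b' -> asymp (a + b) (a' + b').
Proof.
by move=> [aa' a'a] [bb' b'b]; split; apply: proptoD;
  [apply: propto_trans aa' (proptoDl _ _)|apply: propto_trans bb' (proptoDr _ _)
  |apply: propto_trans a'a (proptoDl _ _)|apply: propto_trans b'b (proptoDr _ _)].
Qed.

Definition asympb : rel M := fun a b => `[< asymp a b >].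

Lemma asympb_refl : reflexive asympb.
Proof. by move=> a; apply/asboolP; split; exact: propto_refl. Qed.

Lemma asympb_sym : symmetric asympb.
Proof. by move=> a b; apply/asboolP/asboolP => -[]. Qed.

Lemma asympb_trans : transitive asympb.
Proof.
move=> b a c /asboolP[ab ba] /asboolP[bc cb]; apply/asboolP.
by split; [exact: propto_trans ab bc|exact: propto_trans cb ba].
Qed.

Canonical asymp_equiv := EquivRel asympb asympb_refl asympb_sym asympb_trans.

Definition nabla := {eq_quot asymp_equiv}.

HB.instance Definition _ := Choice.on nabla.
HB.instance Definition _ := EqQuotient.on nabla.

Definition nabla_class a : nabla := \pi_nabla a.

Lemma nabla_classP a b : nabla_class a = nabla_class b <-> asymp a b.
Proof.
by split=> [/eqP|ab]; [rewrite /nabla_class eqmodE => /asboolP|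
  apply/eqP; rewrite /nabla_class eqmodE; apply/asboolP].
Qed.

Definition nabla_join (x y : nabla) : nabla := nabla_class (repr x + repr y).

Definition nabla_le (x y : nabla) : bool := nabla_join x y == y.

Lemma nabla_ind (P : nabla -> Prop) :
  (forall a, P (nabla_class a)) -> forall x, P x.
Proof. by move=> Pc; exact: quotW. Qed.

Lemma nabla_joinE a b :
  nabla_join (nabla_class a) (nabla_class b) = nabla_class (a + b).
Proof.
by apply/nabla_classP/asympD; apply/nabla_classP; rewrite /nabla_class reprK.
Qed.

Lemma nabla_leP a b :
  reflect (propto a b) (nabla_le (nabla_class a) (nabla_class b)).
Proof.
rewrite /nabla_le nabla_joinE.
apply: (iffP eqP) => [/nabla_classP[abb _]|ab].
  exact: propto_trans (proptoDl a b) abb.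
apply/nabla_classP; split; last exact: proptoDr.
by apply: proptoD ab _; exact: propto_refl.
Qed.

Fact nabla_le_refl : reflexive nabla_le.
Proof. by elim/nabla_ind => a; apply/nabla_leP/propto_refl. Qed.

Fact nabla_le_anti : antisymmetric nabla_le.
Proof.
elim/nabla_ind => a; elim/nabla_ind => b /andP[/nabla_leP ab /nabla_leP ba].
exact/nabla_classP.
Qed.

Fact nabla_le_trans : transitive nabla_le.
Proof.
elim/nabla_ind => b; elim/nabla_ind => a; elim/nabla_ind => c.
by move=> /nabla_leP ab /nabla_leP bc; apply/nabla_leP; exact: propto_trans ab bc.
Qed.

Fact nabla_display : Order.disp_t. Proof. exact: Order.Disp tt tt. Qed.

HB.instance Definition _ := Order.Le_isPOrder.Build nabla_display nabla
  nabla_le_refl nabla_le_anti nabla_le_trans.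

Fact nabla_leUx (x y z : nabla) :
  (nabla_join x y <= z)%O = (x <= z)%O && (y <= z)%O.
Proof.
elim/nabla_ind: x => a; elim/nabla_ind: y => b; elim/nabla_ind: z => c.
rewrite nabla_joinE; apply/nabla_leP/andP => [abc|[/nabla_leP ac /nabla_leP bc]].
  split; apply/nabla_leP; apply: propto_trans abc;
    [exact: proptoDl|exact: proptoDr].
exact: proptoD.
Qed.

HB.instance Definition _ := Order.POrder_isJoinSemilattice.Build
  nabla_display nabla nabla_leUx.

Fact nabla_le0x (x : nabla) : (nabla_class 0 <= x)%O.
Proof. by elim/nabla_ind: x => a; apply/nabla_leP/propto0. Qed.

HB.instance Definition _ := Order.hasBottom.Build nabla_display nabla nabla_le0x.

Lemma nabla_class_le a b : (nabla_class a <= nabla_class b)%O <-> propto a b.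
Proof. by split=> /nabla_leP. Qed.

Lemma nabla_classD a b :
  nabla_class (a + b) = (nabla_class a `|` nabla_class b)%O.
Proof. by rewrite -nabla_joinE. Qed.

Lemma nabla_class0 : nabla_class 0 = \bot%O.
Proof. by []. Qed.

End Monoids.

Arguments propto_trans {M b a c}.

Definition aleph0_downward_directed (d : Order.disp_t) (P : porderType d)
    (B : set P) : Prop :=
  forall X : set P, X `<=` B -> countable X ->
    exists b, B b /\ forall x, X x -> (b <= x)%O.

Section Semilattices.
Variables (d : Order.disp_t) (S : bJoinSemilatticeType d).

(* The values of [x] outside the two-element subsets of [F] are irrelevant. *)
Definition wedge2 (A : set S) : set S :=
  [set s | exists (F : {fset S}) (x : {fset S} -> S),
    [/\ [set` F] `<=` A,
        forall a a', a \in F -> a' \in F -> a != a' ->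
          (x [fset a; a']%fset <= a)%O /\ (x [fset a; a']%fset <= a')%O
      & s = (\join_(p <- fpowerset F | #|` p| == 2%N) x p)%O]].

Definition URPsr (e : S) : Prop :=
  forall A B : set S,
    ~ countable A ->
    aleph0_downward_directed B ->
    (forall a b, A a -> B b -> (a <= e)%O /\ (e <= a `|` b)%O) ->
    exists a, wedge2 A a /\ forall b, B b -> (e <= a `|` b)%O.

End Semilattices.

(* Main.v *)
(* Choose representatives of the elements of [A] and [B]. As [A] is uncountable
   and [B] is aleph_0-downward directed, there are m and arbitrarily many
   distinct elements of [A] with representatives a_i <= m e such that, for every
   [b] in [B], e <= a_i + b_i for some b_i with [b_i] <= b. Riesz decomposition
   gives c_ij <= a_i, a_j with a_1 + ... + a_N <= m e + c, where c is the sum of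
   the c_ij; the c_ij do not depend on b. Hence
   N e <= m e + c + (b_1 + ... + b_N), and if N > m k, where k bounds the stable
   rank of e, then m applications of the stable rank condition yield
   e <= c + (b_1 + ... + b_N). *)
Require Import Defs.
From mathcomp Require Import all_boot all_order all_algebra.
From mathcomp Require Import finmap boolp classical_sets cardinality.

Set Implicit Arguments.
Unset Strict Implicit.
Unset Printing Implicit Defensive.

Import Order.TTheory GRing.Theory.
Local Open Scope classical_set_scope.
Local Open Scope ring_scope.

Section RieszMonoids.
Variable M : nmodType.
Implicit Types a b c e u w : M.

Lemma alg_le0 a : alg_le 0 a.
Proof. by exists a; rewrite add0r. Qed.

Lemma alg_leDl a b : alg_le a (a + b).
Proof. by exists b. Qed.

Lemma alg_le_propto a b : alg_le a b -> propto a b.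
Proof. by exists 1%N. Qed.

Lemma asympMn n a : (0 < n)%N -> asymp (a *+ n) a.
Proof.
move=> n0; split; first by exists n; split => //; exact: alg_le_refl.
apply: alg_le_propto; exists (a *+ n.-1).
by rewrite -mulrS prednK.
Qed.

(** Induction on [s], splitting off one summand at a time. Uniqueness of [s] allows [g] to be
    redefined at the head without disturbing the tail. *)
Lemma riesz_sum (I : eqType) (s : seq I) (f : I -> M) w c :
  Riesz_monoid M -> uniq s -> alg_le c (\sum_(i <- s) f i + w) ->
  exists (g : I -> M) t, [/\ forall i, i \in s -> alg_le (g i) (f i),
    alg_le t w & c = \sum_(i <- s) g i + t].
Proof.
move=> rieszM; elim: s c => [|i s IHs] c /=.
  by move=> _; rewrite !big_nil add0r => cw; exists f, c; rewrite big_nil add0r.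
move=> /andP[iNs s_uniq]; rewrite big_cons -addrA => /rieszM[a [b [ai bs ->]]].
have [g [t [gf tw ->]]] := IHs _ s_uniq bs.
exists (fun j => if j == i then a else g j), t; split => //.
  by move=> j; rewrite inE; case: eqVneq => [->|] //= _; exact: gf.
rewrite big_cons eqxx addrA; congr (_ + _ + _).
by apply: eq_big_seq => j js; case: eqVneq => // ji; rewrite -ji js in iNs.
Qed.

(* Each new [r i] lies below [u = \sum_j d j + w]; Riesz decomposition cuts it
   into parts [c i j] below the earlier [d j] and a part [d i] below [w]. *)
Lemma riesz_disjointify (I : eqType) (s : seq I) (r : I -> M) u :
  Riesz_monoid M -> uniq s -> (forall i, i \in s -> alg_le (r i) u) ->
  exists (d : I -> M) (c : I -> I -> M),
    [/\ forall i, i \in s -> alg_le (d i) (r i),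
        alg_le (\sum_(i <- s) d i) u,
        forall i j, i \in s -> j \in s -> i != j ->
          alg_le (c i j) (r i) /\ alg_le (c i j) (r j)
      & \sum_(i <- s) r i =
          \sum_(i <- s) d i + \sum_(i <- s) \sum_(j <- s | i != j) c i j].
Proof.
move=> rieszM; elim: s => [|z s IHs] /=.
  move=> _ _; exists r, (fun=> r).
  by split => //; rewrite !big_nil ?addr0 //; exact: alg_le0.
move=> /andP[zNs s_uniq] ru.
have zN j : j \in s -> (j == z) = false.
  by move=> js; apply: contraNF zNs => /eqP <-.
have [i si|d [c [dr [w uE] cr sumr]]] := IHs s_uniq.
  by apply: ru; rewrite inE si orbT.
have : alg_le (r z) (\sum_(i <- s) d i + w) by rewrite uE; apply/ru/mem_head.
move=> /(riesz_sum rieszM s_uniq)[g [t [gd [v tvw] rz]]].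
exists (fun i => if i == z then t else d i).
(* The double sum runs over ordered pairs, so the overlap of [z] with [j] is recorded at [(z, j)]
   only and [(j, z)] gets 0. *)
exists (fun i j => if i == z then g j else if j == z then 0 else c i j).
have sumd : \sum_(i <- s) (if i == z then t else d i) = \sum_(i <- s) d i.
  by apply: eq_big_seq => j /zN ->.
split.
- move=> i; rewrite inE; case: eqVneq => [->|_] /=; last exact: dr.
  by move=> _; exists (\sum_(i <- s) g i); rewrite rz addrC.
- rewrite big_cons eqxx sumd -uE -tvw [t + _]addrC addrA.
  exact: alg_leDl.
- move=> i j; rewrite !inE; case: (eqVneq i z) => [->|_] /=.
    move=> _; rewrite eq_sym; case: eqVneq => //= _ js _; split.
      exists (\sum_(k <- rem j s) g k + t).
      by rewrite rz (big_rem j js) /= addrA.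
    exact: alg_le_trans (gd _ js) (dr _ js).
  move=> si; case: (eqVneq j z) => [_|_] /=.
    by move=> _ _; split; exact: alg_le0.
  exact: cr.
rewrite !big_cons !eqxx sumd /= sumr rz.
have -> : \sum_(j <- s | z != j) g j = \sum_(j <- s) g j.
  rewrite big_seq_cond [RHS]big_seq; apply: eq_bigl => j.
  by case js: (j \in s); rewrite // eq_sym zN.
have -> : \sum_(i <- s) \sum_(j <- z :: s | i != j)
    (if i == z then g j else if j == z then 0 else c i j) =
    \sum_(i <- s) \sum_(j <- s | i != j) c i j.
  apply: eq_big_seq => i si; rewrite big_cons zN //= eqxx add0r.
  rewrite big_seq_cond [RHS]big_seq_cond.
  by apply: eq_bigr => j /andP[/zN -> _].
by rewrite [_ + t]addrC -!addrA; congr (t + _); rewrite addrCA.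
Qed.

(** Each use of the stable rank condition removes [k] copies of [e] on the left and one on the
    right; the new remainder is absorbed into [a]. *)
Lemma stable_rank_cancel k e m n a b : stable_rank_le k e ->
  e *+ (m * k + n) + a = e *+ m + b -> alg_le (e *+ n) b.
Proof.
move=> ek; elim: m a => [|m IHm] a.
  by rewrite mul0n add0n mulr0n add0r => <-; exact: alg_leDl.
rewrite mulSn -addnA mulrnDr mulrS -!addrA => /ek[z].
by rewrite -addrA; exact: IHm.
Qed.

End RieszMonoids.

Lemma nabla_class_sum_le (M : nmodType) (I : eqType) (s : seq I) (P : pred I)
    (f : I -> M) (t : nabla M) :
  (forall i, i \in s -> P i -> (nabla_class (f i) <= t)%O) ->
  (nabla_class (\sum_(i <- s | P i) f i)%R <= t)%O.
Proof.
move=> ft; rewrite big_seq_cond; elim/big_ind: _ => [|a b at_ bt|i].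
- exact: le0x.
- by rewrite nabla_classD leUx at_.
- by move=> /andP[]; exact: ft.
Qed.

Lemma wedge2_sum (M : nmodType) (A : set (nabla M)) (F : {fset nabla M})
    (r : nabla M -> M) (c : nabla M -> nabla M -> M) :
  [set` F] `<=` A -> {in F, cancel r (@nabla_class M)} ->
  (forall x y, x \in F -> y \in F -> x != y ->
    alg_le (c x y) (r x) /\ alg_le (c x y) (r y)) ->
  exists2 s, wedge2 A s &
    (nabla_class (\sum_(x <- F) \sum_(y <- F | x != y) c x y)%R <= s)%O.
Proof.
move=> FA rK cr.
have cle x y : x \in F -> y \in F -> x != y ->
    (nabla_class (c x y) <= x)%O && (nabla_class (c x y) <= y)%O.
  move=> xF yF xy; have [cx cy] := cr _ _ xF yF xy.
  by rewrite -{2}(rK _ xF) -{3}(rK _ yF); apply/andP; split;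
    apply/nabla_class_le/alg_le_propto.
(* [c] need not be symmetric, whereas [wedge2] takes one value per unordered pair: both orders are
   joined. *)
pose v (p : {fset nabla M}) : nabla M :=
  (\join_(x <- F) \join_(y <- F | (x != y) && (p == [fset x; y]%fset))
    nabla_class (c x y))%O.
exists (\join_(p <- fpowerset F | #|` p| == 2%N) v p)%O.
  exists F, v; split => // a b aF bF ab.
  have vle t : t \in [fset a; b]%fset -> (v [fset a; b]%fset <= t)%O.
    move=> tab; apply/joinsP_seq => x xF _; apply/joinsP_seq => y yF.
    move=> /andP[xy /eqP abE]; move: tab; rewrite abE in_fset2.
    by have /andP[cx cy] := cle _ _ xF yF xy => /orP[]/eqP ->.
  by split; apply: vle; rewrite in_fset2 eqxx ?orbT.
apply: nabla_class_sum_le => x xF _; apply: nabla_class_sum_le => y yF xy.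
have xyF : [fset x; y]%fset \in fpowerset F.
  by rewrite fpowersetE; apply/fsubsetP => z; rewrite in_fset2 => /orP[]/eqP ->.
apply: le_trans (joins_sup_seq _ xyF _); last by rewrite cardfs2 xy.
apply: le_trans (joins_sup_seq _ xF _) => //.
by apply: (joins_sup_seq (fun y => nabla_class (c x y)) yF); rewrite xy eqxx.
Qed.

(** Sharper than an inequality of classes: [a] occurs exactly once, while [b'] is free within the
    bound [b]. *)
Definition le_modulo (M : nmodType) (b : nabla M) (e a : M) : Prop :=
  exists b', (nabla_class b' <= b)%O /\ alg_le e (a + b').

(* The bound on [n] is uniform in [b] because [B] is downward directed for
   sequences: a sequence of counterexamples would have a lower bound in [B]. *)
Lemma uniform_representative (M : nmodType) (e : M) (B : set (nabla M))
    (x : nabla M) :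
  Riesz_monoid M -> aleph0_downward_directed B ->
  (x <= nabla_class e)%O ->
  (forall b, B b -> (nabla_class e <= x `|` b)%O) ->
  exists m a, [/\ nabla_class a = x, alg_le a (e *+ m) &
    forall b, B b -> le_modulo b e a].
Proof.
move=> rieszM Bdir; elim/nabla_ind: x => a /nabla_class_le[m [_ am]] eB.
suff [n [n0 ngood]] : exists n, (0 < n)%N /\
    forall b, B b -> le_modulo b e (a *+ n).
  exists (m * n)%N, (a *+ n); split => //; first exact/nabla_classP/asympMn.
  by rewrite mulrnA; exact: alg_leMn.
apply: contrapT => nex.
have /choice[f fP] n : exists b, B b /\ ~ le_modulo b e (a *+ n.+1).
  apply: contrapT => nb; apply: nex; exists n.+1; split => // b Bb.
  by apply: contrapT => ngb; apply: nb; exists b.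
have [b [Bb bf]] : exists b, B b /\ forall y, range f y -> (b <= y)%O.
  by apply: Bdir => [_ [n _ <-]|]; [have [] := fP n|exact: card_image_le].
have [b0 bE] : exists b0, b = nabla_class b0.
  by elim/nabla_ind: b {Bb bf} => b0; exists b0.
have := eB _ Bb; rewrite bE -nabla_classD => /nabla_class_le[n [n0]].
rewrite -(prednK n0) mulrnDl; move: n.-1 => {n n0} n en.
have [_ ngood] := fP n; apply: ngood; exists (b0 *+ n.+1); split => //.
have -> : nabla_class (b0 *+ n.+1) = b.
  by rewrite bE; exact/nabla_classP/asympMn.
by apply: bf; exists n.
Qed.

Theorem theorem4p3 (M : nmodType) (e : M) :
  Riesz_monoid M -> finite_stable_rank e -> URPsr (nabla_class e).
Proof.
move=> rieszM [k [_ ek]] A B Aunc Bdir AB.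
pose A_ m := [set x | A x /\ exists a,
  [/\ nabla_class a = x, alg_le a (e *+ m) &
    forall b, B b -> le_modulo b e a]].
(* The sets [A_ m] cover [A], which would be countable if all of them were finite. *)
have [m Am_inf] : exists m, infinite_set (A_ m).
  apply: contrapT => Afin; apply: Aunc.
  apply: (@sub_countable _ _ _ (\bigcup_m A_ m)).
    apply: subset_card_le => x Ax.
    (* A lower bound of the empty set shows that [B] is inhabited, which gives access to
       [x <= nabla_class e]. *)
    have [b0 [Bb0 _]] := Bdir set0 (@sub0set _ B) (countable0 _).
    have [b Bb|m [a aP]] :=
      uniform_representative rieszM Bdir (proj1 (AB x b0 Ax Bb0)).
      exact: proj2 (AB x b Ax Bb).
    by exists m => //; split => //; exists a.
  apply: bigcup_countable => // m _; apply: finite_set_countable.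
  by apply: contrapT => Am; apply: Afin; exists m.
(* Cancelling [m] times costs [m * k] copies of [e]; one more must survive. *)
have [F FA cardF] := infinite_set_fset (m * k + 1) Am_inf.
have /choice[r rP] x : exists a, x \in F ->
    [/\ nabla_class a = x, alg_le a (e *+ m) &
    forall b, B b -> le_modulo b e a].
  have [xF|] := boolP (x \in F); last by exists 0.
  by have [_ [a aP]] := FA _ xF; exists a.
have re x : x \in F -> alg_le (r x) (e *+ m) by move=> /rP[].
have [d [c [_ [w dwE] cr sumr]]] := riesz_disjointify rieszM (fset_uniq F) re.
have [| |s sA cs] := wedge2_sum _ _ cr (A := A).
- by move=> x /FA[].
- by move=> x /rP[].
exists s; split => // b Bb.
set y := \sum_(x <- F) \sum_(y <- F | x != y) _ in cs sumr.
have /choice[g gP] x : exists b', x \in F ->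
    (nabla_class b' <= b)%O /\ alg_le e (r x + b').
  have [xF|] := boolP (x \in F); last by exists 0.
  by have [_ _ /(_ _ Bb)[b' b'P]] := rP _ xF; exists b'.
have [z zE] : alg_le (e *+ #|` F|) (\sum_(x <- F) r x + \sum_(x <- F) g x).
  have -> : e *+ #|` F| = \sum_(x <- F) e.
    by rewrite big_const_seq count_predT iter_addr_0.
  rewrite -big_split /= big_seq [X in alg_le _ X]big_seq.
  elim/big_rec2: _ => [|x a1 a2 xF]; first exact: alg_le_refl.
  by apply: alg_leD; have [] := gP _ xF.
have : alg_le (e *+ 1) (y + \sum_(x <- F) g x).
  (* The slack collects the copies of [e] beyond [m * k + 1] and the remainders [z] and [w] of the
     two inequalities. *)
  apply: (stable_rank_cancel (m := m) ek
    (a := e *+ (#|` F| - (m * k + 1)) + z + w)).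
  rewrite !addrA -mulrnDr subnKC // zE sumr -dwE.
  by rewrite [LHS]addrAC [_ + y + w]addrAC.
rewrite mulr1n => /alg_le_propto/nabla_class_le /le_trans; apply.
rewrite nabla_classD; apply: leU2 => //.
by apply: nabla_class_sum_le => x xF _; have [] := gP _ xF.
Qed.
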